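(* Consider the primal-dual algorithm described in the context, run on any instance of $1||\sum f_j$. It outputs a schedule whose cost is at most four times the cost of an optimal schedule.
   Context: Problem $1||\sum f_j$: a finite set $\mathcal{J}$ of $n$ jobs, each job $j$ with a positive integer processing time $p_j$ and a nondecreasing cost function $f_j:\{1,2,\dots\}\to\mathbb{Z}_{\ge 0}$; jobs are processed one at a time, without preemption, on a single machine; $C_j$ is the completion time of $j$; the goal is to minimize $\sum_j f_j(C_j)$. Let $T=\sum_j p_j$, $\mathcal{T}=\{1,\dots,T\}$, $D(t)=T-t+1$, and for $A\subseteq\mathcal{J}$: $D(t,A)=\max\{D(t)-\sum_{j\in A}p_j,0\}$, $p_j(t,A)=\min\{p_j,D(t,A)\}$. Dual variables $y(t,A)\ge 0$ ($t\in\mathcal{T}$, $A\subseteq\mathcal{J}$) are subject to the dual constraints $\sum_{t\in\mathcal{T}:t\le s}\sum_{A:\,j\notin A}p_j(t,A)y(t,A)\le f_j(s)$ for every $j\in\mathcal{J}$, $s\in\mathcal{T}$. The primal-dual algorithm. Initialize all $x_{jt}=0$, all $y(t,A)=0$, and $A_t=\emptyset$ for all $t\in\mathcal{T}$ (and $A_{T+1}=\emptyset$ throughout). Growing phase: repeat the following. Let $t^k$ be a time maximizing $D(t,A_t)$ over $t\in\mathcal{T}$, choosing the largest such time in case of ties. If $D(t^k,A_{t^k})=0$, stop the growing phase. Otherwise increase $y(t^k,A_{t^k})$ as much as possible while keeping all dual constraints satisfied; at that point some dual constraint with right-hand side $f_j(t)$ is tight; choose the one with the largest $t$ (ties among jobs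 broken arbitrarily), set $x_{jt}=1$, and add $j$ to $A_s$ for every $s\le t$. Pruning phase: consider the pairs $(j,t)$ with $x_{jt}=1$ in the reverse of the order in which they were set to $1$. For such a pair: if $j\in A_{t+1}$, set $x_{jt}=0$; else, if $\sum_{j'\in A_s\setminus\{j\}}p_{j'}\ge D(s)$ holds for every $s$ such that $j$ was added to $A_s$ in the growing-phase iteration in which $x_{jt}$ was set to $1$, then set $x_{jt}=0$ and remove $j$ from all these sets $A_s$. Output: for each job $j$ set its due date $d_j$ to the time $t$ with $x_{jt}=1$, and output the schedule processing the jobs without idle time in nondecreasing order of due date (EDD order). *)

(* Defs.v *)
From mathcomp Require Import all_boot all_order all_algebra.

Set Implicit Arguments.
Unset Strict Implicit.
Unset Printing Implicit Defensive.
Import Order.TTheory GRing.Theory Num.Theory.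

Record instance (J : finType) := Instance {
  proc : J -> nat;
  jobcost : J -> nat -> nat;
  proc_gt0 : forall j, 0 < proc j;
  (* only the values at times >= 1 matter; [jobcost j 0] is unconstrained *)
  jobcost_mono : forall j s t, 0 < s -> s <= t -> jobcost j s <= jobcost j t
}.

Section Schedules.
Variables (J : finType) (I : instance J).
Local Notation p := (proc I).
Local Notation f := (jobcost I).

(* A schedule is given by its integral completion times: job j occupies the
   interval (C j - p j, C j].  Idle time is allowed. *)
Definition is_schedule (C : J -> nat) : Prop :=
  (forall j, p j <= C j) /\
  (forall i j, i != j -> C i + p j <= C j \/ C j + p i <= C i).

Definition cost (C : J -> nat) : nat := \sum_(j : J) f j (C j).

Definition is_optimal (C : J -> nat) : Prop :=
  is_schedule C /\ forall C', is_schedule C' -> cost C <= cost C'.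

Definition completion_of_order (s : seq J) (j : J) : nat :=
  \sum_(i <- take (index j s).+1 s) p i.

Definition edd_schedule (d : J -> nat) (C : J -> nat) : Prop :=
  exists s : seq J,
    [/\ perm_eq s (enum J), sorted (fun i j => d i <= d j) s
      & forall j, C j = completion_of_order s j].

Definition horizon : nat := \sum_(j : J) p j.

Definition times : seq nat := index_iota 1 horizon.+1.

Definition demand (t : nat) : nat := horizon - t + 1.

(* Truncated subtraction: max {D(t) - p(A), 0}. *)
Definition residual (t : nat) (A : {set J}) : nat :=
  demand t - \sum_(j in A) p j.

Definition trunc_proc (j : J) (t : nat) (A : {set J}) : nat :=
  minn (p j) (residual t A).

End Schedules.

Section Algorithm.
Variables (R : realFieldType) (J : finType) (I : instance J).
Local Notation p := (proc I).
Local Notation f := (jobcost I).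

Definition dual_lhs (y : nat -> {set J} -> R) (j : J) (s : nat) : R :=
  (\sum_(t <- times I | (t <= s)%N) \sum_(A : {set J} | j \notin A)
     (trunc_proc I j t A)%:R * y t A)%R.

Definition dual_feasible (y : nat -> {set J} -> R) : Prop :=
  (forall t A, t \in times I -> (0 <= y t A)%R) /\
  (forall j s, s \in times I -> (dual_lhs y j s <= (f j s)%:R)%R).

Definition raise (y : nat -> {set J} -> R) (t : nat) (A : {set J}) (e : R) :
    nat -> {set J} -> R :=
  fun t' A' => (if (t' == t) && (A' == A) then y t' A' + e else y t' A')%R.

Definition max_raise (y : nat -> {set J} -> R) (t : nat) (A : {set J})
    (e : R) : Prop :=
  [/\ (0 <= e)%R, dual_feasible (raise y t A e)
    & forall e', dual_feasible (raise y t A e') -> (e' <= e)%R].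

(* The constraint of (j, s) is tight and contains the variable y(t, A), so
   that it is one of those preventing a further increase of y(t, A); tight
   constraints not containing this variable play no role. *)
Definition blocking (y : nat -> {set J} -> R) (t : nat) (A : {set J}) (j : J)
    (s : nat) : Prop :=
  [/\ s \in times I, t <= s, j \notin A & dual_lhs y j s = ((f j s)%:R)%R].

(* [marks] lists, most recent first, the pairs (j, t) in the order in which
   x_{jt} was set to 1, each with the times s at which j was then newly added
   to A_s.  [members s] is A_s; it is empty for s outside 1..T, in particular
   A_{T+1} is empty. *)
Record state := State {
  dual : nat -> {set J} -> R;
  members : nat -> {set J};
  xvar : J -> nat -> bool;
  marks : seq (J * nat * seq nat)
}.

Definition init_state : state :=
  State (fun _ _ => 0%R) (fun _ => set0) (fun _ _ => false) [::].

Definition mark (st : state) (y : nat -> {set J} -> R) (j : J) (t : nat) :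
    state :=
  State y
    (fun s => if (s \in times I) && (s <= t) then j |: members st s
              else members st s)
    (fun i s => if (i == j) && (s == t) then true else xvar st i s)
    ((j, t, [seq s <- times I | (s <= t) && (j \notin members st s)])
       :: marks st).

Definition selected (A : nat -> {set J}) (tk : nat) : Prop :=
  [/\ tk \in times I,
      (forall t, t \in times I -> residual I t (A t) <= residual I tk (A tk))
    & (forall t, t \in times I ->
         residual I t (A t) = residual I tk (A tk) -> t <= tk)].

(* The maximal residual demand is 0; phrased so as to make sense when there
   are no jobs, hence no times. *)
Definition stopped (st : state) : Prop :=
  forall t, t \in times I -> residual I t (members st t) = 0.

Inductive grow_step (st : state) : state -> Prop :=
  GrowStep tk e j t of
      selected (members st) tk
    & 0 < residual I tk (members st tk)
    & max_raise (dual st) tk (members st tk) e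
    & blocking (raise (dual st) tk (members st tk) e) tk (members st tk) j t
    & (forall i s,
         blocking (raise (dual st) tk (members st tk) e) tk (members st tk) i s
         -> s <= t) :
    grow_step st (mark st (raise (dual st) tk (members st tk) e) j t).

Inductive reachable : state -> Prop :=
| reachable_init : reachable init_state
| reachable_step st st' : reachable st -> grow_step st st' -> reachable st'.

Definition prune_step (xA : (J -> nat -> bool) * (nat -> {set J}))
    (m : J * nat * seq nat) : (J -> nat -> bool) * (nat -> {set J}) :=
  let: (x, A) := xA in
  let: (j, t, added) := m in
  let x' := fun i s => if (i == j) && (s == t) then false else x i s in
  if j \in A t.+1 then (x', A)
  else if all (fun s => demand I s <= \sum_(i in A s :\ j) p i) added then
    (x', fun s => if s \in added then A s :\ j else A s)
  else (x, A).

Definition prune (st : state) : J -> nat -> bool :=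
  (foldl prune_step (xvar st, members st) (marks st)).1.

(* [C] is the schedule output, for some EDD order, when the growing phase ends
   in [st]; in particular every job has exactly one due date. *)
Definition outputs (st : state) (C : J -> nat) : Prop :=
  exists d : J -> nat,
    (forall j t, prune st j t = (t == d j)) /\ edd_schedule I d C.

End Algorithm.

(* Main.v *)
(* Let y(t,A) > 0, let r = D(t,A) be the maximal residual demand in the iteration
   that raised it, and write C_s for the set A_s in that iteration.  A job j not
   in A whose final due date d_j is at least t was kept by the pruning phase
   because of a critical time s_j <= d_j: the jobs i <> j with s_j <= d_i,
   together with the set A_{s_j} just before j was marked, do not cover D(s_j).
   Since that set contains C_{s_j} and D(s_j, C_{s_j}) <= r, those of these jobs
   lying outside C_{s_j} have total processing time less than r.  Among the jobs
   with s_j <= t apply this to one of largest s_j, and among those with s_j > t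
   to one of smallest s_j: in either group all other jobs then qualify, so each
   group contributes at most r + r to the sum of the p_j(t,A).  Hence that sum is
   at most 4 D(t,A).  Every constraint (j, d_j) is tight, so the due date costs
   are at most 4 times the dual objective, which bounds the cost of any schedule
   from below, and the EDD order meets all due dates. *)

Require Import Defs.
From mathcomp Require Import all_boot all_order all_algebra.
From mathcomp Require Import zify.

Set Implicit Arguments.
Unset Strict Implicit.
Unset Printing Implicit Defensive.
Import Order.TTheory GRing.Theory Num.Theory.

(** * General facts on suffixes and sums *)

Lemma suffix_size_le (T : eqType) (a b c : seq T) :
  suffix a c -> suffix b c -> size a <= size b -> suffix a b.
Proof.
move=> sa sb ab; have bc := size_suffix sb.
move: sa sb; rewrite !suffixE => /eqP sa /eqP sb.
rewrite -[X in drop _ X]sb drop_drop; apply/eqP.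
by have -> : size b - size a + (size c - size b) = size c - size a by lia.
Qed.

Lemma leq_sum_sub (T : finType) (P Q : pred T) (F : T -> nat) :
  (forall i, P i -> Q i) -> \sum_(i | P i) F i <= \sum_(i | Q i) F i.
Proof. by apply: sub_le_big => // x y; apply: leq_addr. Qed.

(** * Feasible schedules, knapsack-cover inequalities and EDD orders *)

Section Scheduling.
Variables (J : finType) (I : instance J).
Local Notation p := (proc I).

Lemma mem_times t : (t \in times I) = (0 < t <= horizon I).
Proof. by rewrite mem_index_iota ltnS. Qed.

Lemma sum_proc_le_horizon (A : {set J}) : \sum_(j in A) p j <= horizon I.
Proof.
rewrite /horizon [leqRHS](bigID (mem A)) /=; exact: leq_addr.
Qed.

(** Induction on the size of [S]: all its other jobs are done when its last job [j] starts, at time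
    [C j - p j]. *)
Lemma sum_completed_le (C : J -> nat) (u : nat) (S : {set J}) :
  is_schedule I C -> (forall j, j \in S -> C j <= u) -> \sum_(j in S) p j <= u.
Proof.
case=> Cge Cdisj; have [n] := ubnP #|S|; elim: n S u => // n IHn S u ltSn leSu.
have [-> | [j0 j0S]] := set_0Vmem S; first by rewrite big_set0.
case: (arg_maxnP C j0S) => j jS maxj; have {}jS : j \in S by [].
rewrite (big_setD1 j) //=.
have : \sum_(i in S :\ j) p i <= C j - p j.
  apply: IHn => [|i]; first by move: ltSn; rewrite (cardsD1 j S) jS /=; lia.
  rewrite !inE => /andP[nij iS].
  have := maxj _ iS; have := Cdisj _ _ nij; have := proc_gt0 I i; rewrite /=; lia.
by have := Cge j; have := leSu _ jS; lia.
Qed.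

(** One late job outside [A] with [p j] at least the residual demand suffices alone. Otherwise no
    term is truncated, and since the jobs completed before [t] take at most [t - 1] units, the
    remaining ones have total at least D(t). *)
Lemma knapsack_cover (C : J -> nat) (t : nat) (A : {set J}) :
  is_schedule I C -> t \in times I ->
  residual I t A <= \sum_(j | (t <= C j) && (j \notin A)) trunc_proc I j t A.
Proof.
move=> schC; rewrite mem_times => /andP[t0 tT].
case: (boolP [exists j, [&& t <= C j, j \notin A & residual I t A <= p j]]).
  case/existsP=> j /and3P[tC jA rp].
  rewrite (bigD1 j) ?tC //= {1}/trunc_proc.
  by rewrite (minn_idPr rp) leq_addr.
move=> /existsPn small.
rewrite (eq_bigr p) => [|j /andP[tC jA]]; last first.
  apply/minn_idPl; have := small j; rewrite tC jA /= -ltnNge; exact: ltnW.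
have early : \sum_(j in [set j | C j < t]) p j <= t.-1.
  by apply: (sum_completed_le schC) => j; rewrite inE; lia.
have : \sum_(j in [set j | t <= C j]) p j <=
       \sum_(j in A) p j + \sum_(j | (t <= C j) && (j \notin A)) p j.
  rewrite (bigID (mem A)) /=; apply: leq_add.
    rewrite [leqRHS](bigID (fun j => t <= C j)) /=.
    apply: leq_trans (leq_addr _ _).
    by under eq_bigl do rewrite inE andbC.
  by under eq_bigl do rewrite inE.
have : horizon I = \sum_(j in [set j | C j < t]) p j + \sum_(j in [set j | t <= C j]) p j.
  rewrite /horizon (bigID (fun j => C j < t)) /=; congr (_ + _);
  by apply: eq_bigl => j; rewrite inE // -leqNgt.
rewrite /residual /demand; lia.
Qed.

Lemma edd_is_schedule (d C : J -> nat) : edd_schedule I d C -> is_schedule I C.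
Proof.
case=> s [sE _ CE].
have us : uniq s by rewrite (perm_uniq sE) enum_uniq.
have ms j : j \in s by rewrite (perm_mem sE) mem_enum.
have split j : C j = \sum_(i <- take (index j s) s) p i + p j.
  rewrite CE /completion_of_order (take_nth j) ?index_mem //.
  by rewrite nth_index // -cats1 big_cat big_seq1.
have mono i j : index i s < index j s -> C i + p j <= C j.
  move=> ij; rewrite (split j) CE /completion_of_order leq_add2r.
  by rewrite -(subnKC ij) takeD big_cat leq_addr.
split=> [j|i j nij]; first by rewrite split leq_addl.
case: (ltngtP (index i s) (index j s)) => [/mono|/mono|eqi]; [by left|by right|].
by case/eqP: nij; rewrite -(nth_index i (ms i)) eqi nth_index.
Qed.

Lemma edd_exists (d : J -> nat) : exists C, edd_schedule I d C.
Proof.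
pose s := sort (fun i j => d i <= d j) (enum J).
exists (completion_of_order I s), s; split=> //; first by rewrite perm_sort.
by apply: sort_sorted => i j; apply: leq_total.
Qed.

(** In EDD order only jobs due by [d j] precede [j]. If [d j] is below the horizon, the covering
    condition at [(d j).+1] leaves these jobs at most [d j] units; otherwise the bound is
    trivial. *)
Lemma edd_meets_due_dates (d C : J -> nat) :
  (forall j, d j \in times I) ->
  (forall s, s \in times I -> demand I s <= \sum_(j | s <= d j) p j) ->
  edd_schedule I d C -> forall j, C j <= d j.
Proof.
move=> dT cov [s [sE ss CE]] j.
have us : uniq s by rewrite (perm_uniq sE) enum_uniq.
have ms i : i \in s by rewrite (perm_mem sE) mem_enum.
have leC : C j <= \sum_(i | d i <= d j) p i.
  rewrite CE /completion_of_order.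
  rewrite big_uniq ?take_uniq //=; apply: leq_sum_sub => i.
  rewrite in_take // ltnS => ij.
  have tr : transitive (fun i j => d i <= d j) by move=> a b c; apply: leq_trans.
  have := sorted_leq_nth tr (fun i => leqnn (d i)) j ss.
  move=> /(_ (index i s) (index j s)); rewrite !inE !index_mem !nth_index // !ms.
  exact.
have := dT j; rewrite mem_times => /andP[d0 dT'].
have tot : horizon I = \sum_(i | d i <= d j) p i + \sum_(i | (d j).+1 <= d i) p i.
  rewrite /horizon (bigID (fun i => d i <= d j)) /=; congr (_ + _).
  by apply: eq_bigl => i; rewrite -ltnNge.
case: (ltnP (d j) (horizon I)) => [lt|ge]; last by apply: leq_trans leC _; lia.
have := cov (d j).+1; rewrite mem_times lt /= /demand => /(_ isT); lia.
Qed.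

End Scheduling.

(** * The pruning phase: marks, critical times and the factor four *)

Section Marks.
Variables (J : finType) (I : instance J).
Local Notation p := (proc I).
Local Notation mark_seq := (seq (J * nat * seq nat)).
Implicit Types (ms : mark_seq) (d : J -> nat).

(* The set [A_s] right after the marks [ms]; earlier stages of the growing phase
   correspond to suffixes of [ms]. *)
Definition covered ms (s : nat) : {set J} :=
  [set j | (s \in times I) && has (fun m => (m.1.1 == j) && (s <= m.1.2)) ms].

Fixpoint wf_marks ms : Prop :=
  if ms is m :: ms' then
    [/\ m.1.2 \in times I,
        exists2 s, s \in times I & (s <= m.1.2) && (m.1.1 \notin covered ms' s),
        m.2 = [seq s <- times I | (s <= m.1.2) && (m.1.1 \notin covered ms' s)]
      & wf_marks ms']
  else True.

Lemma covered_cons m ms s j :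
  (j \in covered (m :: ms) s) =
  (s \in times I) && (((m.1.1 == j) && (s <= m.1.2)) || (j \in covered ms s)).
Proof. by rewrite !inE /=; case: (s \in times I). Qed.

Lemma coveredP ms s j : s \in times I ->
  reflect (exists t a, (j, t, a) \in ms /\ s <= t) (j \in covered ms s).
Proof.
move=> sT; rewrite inE sT; apply: (iffP hasP) => [[[[i t] a] im]|[t [a [im st]]]].
  by case/andP=> /= /eqP <- st; exists t, a.
by exists (j, t, a); rewrite //= eqxx.
Qed.

Lemma covered_suffix ms ms' s j :
  suffix ms ms' -> j \in covered ms s -> j \in covered ms' s.
Proof.
by case/suffixP=> l ->; rewrite !inE has_cat => /andP[-> ->]; rewrite orbT.
Qed.

(** Each mark adds its job to some new set, so the times marked for one job strictly increase. *)
Lemma wf_marks_lt m ms t a :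
  wf_marks (m :: ms) -> (m.1.1, t, a) \in ms -> t < m.1.2.
Proof.
case=> _ [s sT /andP[st nin]] _ _ im; rewrite ltnNge; apply/negP=> le.
by case/negP: nin; apply/(coveredP _ _ sT); exists t, a; split=> //; apply: leq_trans le.
Qed.

(* The time [s] is why the mark [(j, d j)] survives the pruning phase: the
   union below is what covers [s] besides [j] when that mark is examined.  Here
   [ms0] is the part of [ms] not examined yet; marks kept later lie in [ms'], so
   they do not enlarge the union. *)
Definition critical ms ms0 d (j : J) (s : nat) : Prop :=
  [/\ s \in times I, s <= d j &
    exists ms' a, [/\ suffix ms0 ms', suffix ((j, d j, a) :: ms') ms, j \notin covered ms' s
      & \sum_(i in covered ms' s :|: [set i | (i != j) && (s <= d i)]) p i
          < demand I s]].

Definition covering d : Prop :=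
  forall s, s \in times I -> demand I s <= \sum_(j | s <= d j) p j.

(** Two suffixes of [ms] are comparable; if [ms0] contained the mark at [x], it would already cover
    [j] at [t]. *)
Lemma suffix_before_mark ms ms0 ms' j x a t :
  suffix ms0 ms -> suffix ((j, x, a) :: ms') ms ->
  t \in times I -> t <= x -> j \notin covered ms0 t -> suffix ms0 ms'.
Proof.
move=> suf0 suf tT tx njt; case: (leqP (size ms0) (size ms')) => [le|gt].
  apply: (@suffix_size_le _ _ _ ms) => //; apply: suffix_trans suf.
  exact: suffix_cons.
have /suffixP[l E] : suffix ((j, x, a) :: ms') ms0.
  exact: suffix_size_le suf suf0 gt.
case/negP: njt; apply/(coveredP _ _ tT); exists x, a; split=> //.
by rewrite E mem_cat mem_head orbT.
Qed.

(** [H] is disjoint from [covered ms0 s], and both lie in the union given by the criticality of [s],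
    whose total is below D(s). *)
Lemma critical_sum_lt ms ms0 ms1 d j s t r (H : {set J}) :
  suffix ms0 ms -> critical ms ms1 d j s ->
  t \in times I -> t <= d j -> j \notin covered ms0 t ->
  residual I s (covered ms0 s) <= r ->
  (forall i, i \in H -> [/\ i != j, s <= d i & i \notin covered ms0 s]) ->
  \sum_(i in H) p i < r.
Proof.
move=> suf0 [sT sd [ms' [a [_ suf njs lt]]]] tT td njt resr HP.
have suf0' := suffix_before_mark suf0 suf tT td njt.
suff : \sum_(i in covered ms0 s) p i + \sum_(i in H) p i < demand I s.
  by move: resr; rewrite /residual; lia.
apply: leq_ltn_trans lt.
rewrite [leqRHS](bigID (mem (covered ms0 s))) /=; apply: leq_add.
  apply: leq_sum_sub => i ic; rewrite ic andbT in_setU.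
  by rewrite (covered_suffix suf0').
apply: leq_sum_sub => i /HP[nij si ->]; rewrite andbT in_setU [_ \in finset _]inE.
by rewrite nij si orbT.
Qed.

(** Truncation charges the one exceptional job [j] at most [r]; the quantifier over [i0] asks for
    such a job only if [H] is nonempty. *)
Lemma sum_minn_le_double (H : {set J}) r :
  (forall i0, i0 \in H -> exists2 j, j \in H & \sum_(i in H :\ j) p i < r) ->
  \sum_(i in H) minn (p i) r <= 2 * r.
Proof.
case: (set_0Vmem H) => [-> _|[i0 i0H] /(_ _ i0H)[j jH lt]]; first by rewrite big_set0.
rewrite (big_setD1 j) //= mul2n -addnn; apply: leq_add; first exact: geq_minr.
by apply: leq_trans (ltnW lt); apply: leq_sum => i _; apply: geq_minl.
Qed.

Lemma raised_sum_le ms ms0 d t :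
  suffix ms0 ms -> (forall j, exists s, critical ms [::] d j s) -> t \in times I ->
  (forall s, s \in times I ->
     residual I s (covered ms0 s) <= residual I t (covered ms0 t)) ->
  \sum_(j | (t <= d j) && (j \notin covered ms0 t))
     trunc_proc I j t (covered ms0 t) <= 4 * residual I t (covered ms0 t).
Proof.
move=> suf0 /fin_all_exists[w wP] tT; set r := residual I t _ => resr.
pose F := [set j | (t <= d j) && (j \notin covered ms0 t)].
have FP j : j \in F -> t <= d j /\ j \notin covered ms0 t.
  by rewrite inE => /andP[].
have wT j : w j \in times I by case: (wP j).
have wd j : w j <= d j by case: (wP j).
have lt j (H : {set J}) : j \in F ->
    (forall i, i \in H -> [/\ i != j, w j <= d i & i \notin covered ms0 (w j)]) ->
    \sum_(i in H) p i < r.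
  by move=> /FP[td nj]; apply: critical_sum_lt (wP j) tT td nj (resr _ (wT j)).
have coveredW u v i : u \in times I -> v \in times I -> u <= v ->
    i \in covered ms0 v -> i \in covered ms0 u.
  move=> uT vT uv /(coveredP _ _ vT)[x [a [im vx]]]; apply/(coveredP _ _ uT).
  by exists x, a; split=> //; apply: leq_trans vx.
rewrite (eq_bigl (mem F)) => [|j]; last by rewrite !inE.
rewrite (bigID (fun j => w j <= t)) /= (_ : 4 * r = 2 * r + 2 * r); last by lia.
apply: leq_add.
  (* Critical times up to [t]: compare with the job of largest critical time. *)
  pose G := [set j in F | w j <= t].
  rewrite (eq_bigl (mem G)) => [|j]; last by rewrite [RHS]inE.
  apply: sum_minn_le_double => i0 i0G.
  case: (@arg_maxnP _ _ (mem G) w i0G) => j jG maxj; exists j => //.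
  have /andP[jF jt] : (j \in F) && (w j <= t) by move: jG; rewrite /= [_ \in G]inE.
  apply: (lt j) => // i; rewrite in_setD1 [_ \in G]inE => /and3P[nij iF wit].
  have [td nit] := FP _ iF.
  split=> //; first exact: leq_trans td.
  have iG : i \in G by rewrite inE iF.
  have := maxj _ iG => wij.
  (* If [i] were covered at [w j], it would also be covered at [w i <= w j], against the criticality
     of [w i]. *)
  have [_ _ [ms' [a [_ suf niw _]]]] := wP i.
  have suf0' := suffix_before_mark suf0 suf tT td nit.
  apply: contra niw => iw; apply: (covered_suffix suf0').
  exact: coveredW iw.
(* Critical times after [t]: compare with the job of smallest critical time. *)
pose L := [set j in F | ~~ (w j <= t)].
rewrite (eq_bigl (mem L)) => [|j]; last by rewrite [RHS]inE.
apply: sum_minn_le_double => i0 i0L.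
case: (@arg_minnP _ _ (mem L) w i0L) => j jL minj; exists j => //.
have /andP[jF jt] : (j \in F) && ~~ (w j <= t) by move: jL; rewrite /= [_ \in L]inE.
apply: (lt j) => // i; rewrite in_setD1 [_ \in L]inE => /and3P[nij iF wit].
have [td nit] := FP _ iF.
have iL : i \in L by rewrite inE iF.
split=> //; first exact: leq_trans (minj _ iL) (wd i).
(* Since [t < w j], a job covered at [w j] would be covered at [t]. *)
by apply: contra nit => iw; apply: coveredW iw => //; apply: ltnW; rewrite ltnNge.
Qed.


(* The state of the pruning phase when [ms0] is the part of [ms] not examined
   yet; [d j] is the kept due date of [j], or 0 if no mark of [j] is kept yet. *)
Definition pruned ms ms0 (x : J -> nat -> bool) (A : nat -> {set J}) d : Prop :=
  [/\ forall j s,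
        (j \in A s) = (s \in times I) && ((j \in covered ms0 s) || (s <= d j)),
      forall j t,
        x j t = has (fun m => m.1 == (j, t)) ms0 || (0 < d j) && (t == d j),
      forall s, s \in times I -> demand I s <= \sum_(i in A s) p i,
      forall j, 0 < d j ->
        d j \in times I /\ forall t a, (j, t, a) \in ms0 -> t < d j
    & forall j, 0 < d j -> exists s, critical ms ms0 d j s].

(** A newly kept due date never spoils an older critical time: its mark was still unexamined then,
    so it lies in the [ms'] of that time, which already covers the job there. *)
Lemma prune_step_pruned ms m ms0 x A d :
  wf_marks (m :: ms0) -> suffix (m :: ms0) ms -> pruned ms (m :: ms0) x A d ->
  exists d', pruned ms ms0 (prune_step I (x, A) m).1 (prune_step I (x, A) m).2 d'.
Proof.
case: m => [[j t] added] wf suf [AE xE cov dT wit].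
have ltm t' a : (j, t', a) \in ms0 -> t' < t by apply: (@wf_marks_lt (j, t, added)).
have [/= tT _ addE _] := wf.
have suf0 : suffix ms0 ((j, t, added) :: ms0) by apply: suffix_cons.
have t0 : 0 < t by move: tT; rewrite mem_times => /andP[].
have dt : 0 < d j -> t < d j.
  by case/dT => _ /(_ t added); rewrite mem_head; apply.
have x'E : (forall s, ~~ has (fun m => m.1 == (j, s)) ms0 || (s < t)) by
  move=> s; apply/orP; case: hasP => [[[[i u] a] im /eqP/= [ei eu]]|_]; [right|left=> //];
  apply: (ltm _ a); rewrite -ei -eu.
have witS : forall i, 0 < d i -> exists s, critical ms ms0 d i s.
  move=> i /wit[s [sT sd [ms' [a [s1 s2 ns lt]]]]]; exists s; split=> //.
  by exists ms', a; split=> //; apply: suffix_trans s1.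
have dTS : forall i, 0 < d i ->
    d i \in times I /\ forall t a, (i, t, a) \in ms0 -> t < d i.
  move=> i /dT[iT ilt]; split=> // u a im; apply: (ilt _ a).
  by rewrite inE im orbT.
have x'0 : ~~ ((0 < d j) && (t == d j)).
  by apply/andP=> -[/dt]; lia.
have xd i s : (if (i == j) && (s == t) then false else x i s) =
    has (fun m => m.1 == (i, s)) ms0 || (0 < d i) && (s == d i).
  rewrite xE /=; case: ifP => [/andP[/eqP -> /eqP ->]|nij].
    by have := x'E t; rewrite ltnn orbF (negPf x'0) orbF => /negPf ->.
  by have -> : ((j, t) == (i, s)) = false by rewrite eq_sym xpair_eqE.
have AE0 i s : i != j -> (i \in A s) =
    (s \in times I) && ((i \in covered ms0 s) || (s <= d i)).
  move=> nij; rewrite AE covered_cons /= [j == i]eq_sym (negPf nij) /=.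
  by case: (s \in times I).
(* Marks of [j] still to be examined are earlier than [t], and a kept one is later, so [j] is in
   A_{t+1} exactly when a due date of [j] is already kept. *)
rewrite /prune_step; case: ifP => [jt|jt].
  have dj : t < d j.
    move: jt; rewrite AE covered_cons => /andP[t1T].
    rewrite t1T /= ltnn andbF /= => /orP[/(coveredP _ _ t1T)[u [a [/ltm]]]|//]; lia.
  exists d; split=> // i s; case: (eqVneq i j) => [->|/AE0//].
  have sd : s <= t -> s <= d j by move=> st; apply: leq_trans (ltnW dj).
  rewrite AE covered_cons eqxx /=; case: (s \in times I) => //=.
  by case: (s <= t) sd => [->|_] //; rewrite ?orbT.
have dj0 : d j = 0.
  case: (posnP (d j)) => // d0; move: (d0) jt => /dT[djT _]; rewrite AE (dt d0) orbT.
  by move: djT (dt d0); rewrite !mem_times => /andP[_ dT'] lt; rewrite ltn0Sn (leq_trans lt).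
have jA s : (j \in A s) = (s \in times I) && ((s <= t) || (j \in covered ms0 s)).
  rewrite AE covered_cons eqxx dj0; case: (boolP (s \in times I)) => //=.
  by rewrite mem_times; case: s => //= s; rewrite orbF.
have addedE s : (s \in added) = [&& s \in times I, s <= t & j \notin covered ms0 s].
  by rewrite addE mem_filter andbC.
case: ifP => [/allP redundant|/negbT /allPn[s]].
  exists d; split=> //= [i s|s sT].
    case: (eqVneq i j) => [->|nij]; last first.
      by rewrite -AE0 //; case: ifP => //; rewrite in_setD1 nij.
    rewrite addedE dj0; case: (boolP (s \in times I)) => sT /=; last first.
      by rewrite jA (negPf sT).
    have -> : (s <= 0) = false by move: sT; rewrite mem_times; lia.
    rewrite orbF; case: ifP => [/andP[_ /negPf ->]|]; first by rewrite !inE eqxx.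
    by rewrite jA sT /=; case: (_ <= _); case: (_ \in covered _ _).
  by case: ifP => [/redundant|_]; last exact: cov.
rewrite addedE => /and3P[sT st njs]; rewrite -ltnNge => lt.
(* The mark is kept, and the time [s] failing the redundancy test becomes the critical time of
   [j]. *)
pose d' i := if i == j then t else d i.
have d'j : d' j = t by rewrite /d' eqxx.
have d'N i : i != j -> d' i = d i by rewrite /d' => /negPf ->.
exists d'; split=> /= [i u|i u|//|i|i].
- by case: (eqVneq i j) => [->|nij]; [rewrite jA d'j orbC|rewrite AE0 // d'N].
- rewrite xE /= [(j, t) == _]eq_sym xpair_eqE; case: (eqVneq i j) => [->|/d'N -> //].
  by rewrite d'j dj0 t0 /= orbF orbC.
- by case: (eqVneq i j) => [->|/d'N -> /dTS //]; rewrite d'j.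
case: (eqVneq i j) => [->|nij].
  exists s; split=> //; rewrite ?d'j //; exists ms0, added; split=> //.
    exact: suffix_refl.
  apply: leq_ltn_trans lt; apply: leq_sum_sub => k; rewrite in_setU in_setD1.
  rewrite [_ \in finset _]inE => /orP[kc|/andP[nkj]].
    have nkj : k != j by apply: contraNneq njs => <-.
    by rewrite nkj AE0 // sT kc.
  by rewrite d'N // => sk; rewrite nkj AE0 // sT sk orbT.
rewrite d'N // => /wit[u [uT ud [ms' [a [s1 s2 ns ltu]]]]]; exists u.
split; rewrite ?d'N //; exists ms', a; split=> //; first exact: suffix_trans s1.
apply: leq_ltn_trans ltu; apply: leq_sum_sub => k.
case/setUP=> [kc|]; first by rewrite in_setU kc.
rewrite inE => /andP[nki uk]; apply/setUP.
case: (eqVneq k j) nki uk => [->|/d'N ->] nki uk; last by right; rewrite inE nki.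
left; apply: (covered_suffix s1); rewrite covered_cons uT /= eqxx /=.
by rewrite -d'j uk.
Qed.

Lemma foldl_prune_pruned ms x A d ms0 :
  wf_marks ms0 -> suffix ms0 ms -> pruned ms ms0 x A d ->
  exists d', pruned ms [::] (foldl (prune_step I) (x, A) ms0).1
                            (foldl (prune_step I) (x, A) ms0).2 d'.
Proof.
elim: ms0 x A d => [|m ms0 IH] x A d wf suf; first by exists d.
case/(prune_step_pruned wf suf) => d'.
rewrite -[foldl _ _ _]/(foldl (prune_step I) (prune_step I (x, A) m) ms0).
case: (prune_step I (x, A) m) => x' A' pr; apply: IH pr; first by case: wf.
by apply: suffix_trans suf; apply: suffix_cons.
Qed.

Lemma pruned_due_dates ms x A d :
  pruned ms [::] x A d ->
  [/\ forall j, d j \in times I, forall j t, x j t = (t == d j), covering d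
    & forall j, exists s, critical ms [::] d j s].
Proof.
case=> AE xE cov dT wit.
have AE' j s : s \in times I -> (j \in A s) = (s <= d j).
  by move=> sT; rewrite AE sT /= inE /= andbF.
(* D(1) equals the total processing time, so covering time 1 needs every job, and each keeps a
   mark. *)
have d0 j : 0 < d j.
  have pj := proc_gt0 I j; have := sum_proc_le_horizon I [set j].
  rewrite big_set1 => pT.
  have T1 : 1 \in times I by rewrite mem_times; lia.
  rewrite -AE' //; apply: contraT => nj; have := cov _ T1; rewrite /demand.
  have := sum_proc_le_horizon I (j |: A 1); rewrite big_setU1 //=; lia.
split=> [j|j t|s sT|j]; [by case: (dT _ (d0 j))|by rewrite xE /= d0| |exact: wit].
by rewrite (leq_trans (cov _ sT)) //; apply: leq_sum_sub => j; rewrite AE'.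
Qed.
End Marks.

(** * Dual sums and the maximal raise of a variable *)

Section PrimalDual.
Variables (R : realFieldType) (J : finType) (I : instance J).
Local Notation f := (jobcost I).
Implicit Types (y : nat -> {set J} -> R) (st : state R J).

(** Exchange of summation. With completion times capped at the horizon it serves weak duality, with
    due dates the upper bound on the output. *)
Lemma sum_dual_lhs y (c : J -> nat) :
  (\sum_j dual_lhs I y j (c j) =
   \sum_(t <- times I) \sum_(A : {set J})
     (\sum_(j | (t <= c j)%N && (j \notin A)) trunc_proc I j t A)%N%:R * y t A)%R.
Proof.
rewrite /dual_lhs; under eq_bigr do rewrite big_mkcond.
rewrite exchange_big; apply: eq_bigr => t _.
rewrite -big_mkcond; under eq_bigr do rewrite big_mkcond.
rewrite exchange_big; apply: eq_bigr => A _.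
by rewrite natr_sum mulr_suml -big_mkcondr.
Qed.

Lemma dual_lhs_raise y t A e j s : t \in times I ->
  (dual_lhs I (raise y t A e) j s =
   dual_lhs I y j s +
   if (t <= s)%N && (j \notin A) then (trunc_proc I j t A)%:R * e else 0)%R.
Proof.
move=> tT; pose c : R := ((trunc_proc I j t A)%:R * e)%R.
have E t' A' : ((trunc_proc I j t' A')%:R * raise y t A e t' A' =
    (trunc_proc I j t' A')%:R * y t' A' +
    if t' == t then (if A' == A then c else 0) else 0)%R.
  rewrite /raise; case: eqP => [->|_]; last by rewrite addr0.
  by case: eqP => [->|_]; rewrite /= ?addr0 // mulrDr.
rewrite /dual_lhs; under eq_bigr do (under eq_bigr do rewrite E; rewrite big_split).
rewrite big_split; congr (_ + _)%R; rewrite /= big_mkcond.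
rewrite (bigD1_seq t) ?iota_uniq //= eqxx.
rewrite [X in (_ + X)%R]big1 ?addr0 => [|u /negPf ut]; last first.
  by rewrite ut big1_eq; case: ifP.
case: (t <= s) => //=; case: ifP => jA.
  rewrite (bigD1 A) //= eqxx big1 ?addr0 // => A' /andP[_ /negPf ->] //.
by rewrite big1 // => A' jA'; case: eqP => // AA; rewrite -AA jA' in jA.
Qed.

Lemma trunc_proc_gt0 j t A : 0 < residual I t A -> 0 < trunc_proc I j t A.
Proof. by rewrite /trunc_proc leq_min (proc_gt0 I j). Qed.

(** Ratio test: [e] is the least quotient of slack by coefficient over the constraints containing
    y(t,A). One exists at the horizon, because a positive residual demand leaves some job outside
    [A]. *)
Lemma exists_max_raise y t A :
  dual_feasible I y -> t \in times I -> 0 < residual I t A ->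
  exists e, max_raise I y t A e /\
    exists j s, blocking I (raise y t A e) t A j s.
Proof.
case=> y0 yf tT res0.
have tr0 j : (0 < (trunc_proc I j t A)%:R :> R)%R.
  by rewrite ltr0n trunc_proc_gt0.
have [j0 j0A] : exists j, j \notin A.
  apply/existsP; rewrite -negb_forall; apply/negP => /forallP AT.
  move: tT res0; rewrite mem_times /residual /demand /horizon.
  rewrite [\sum_(j in A) _](eq_bigl xpredT) => [|j]; first by lia.
  exact: AT.
pose P (i : J * 'I_(horizon I).+1) :=
  [&& (i.2 : nat) \in times I, t <= i.2 & i.1 \notin A].
pose r (i : J * 'I_(horizon I).+1) : R :=
  (((f i.1 i.2)%:R - dual_lhs I y i.1 i.2) / (trunc_proc I i.1 t A)%:R)%R.
have P0 : P (j0, ord_max).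
  by move: tT; rewrite /P j0A !mem_times /=; lia.
case: (arg_minP r P0) => -[j s] /and3P[/= sT ts jA] minr.
set e := r (j, s) in minr.
have e0 : (0 <= e)%R by rewrite divr_ge0 ?ler0n // subr_ge0 yf.
have tight : (dual_lhs I (raise y t A e) j s = (f j s)%:R)%R.
  rewrite dual_lhs_raise // ts jA /e /r /= mulrC divfK ?lt0r_neq0 //.
  by rewrite addrC subrK.
exists e; split; last by exists j, s.
split=> //; last first.
  move=> e' [_ /(_ j s sT)]; rewrite dual_lhs_raise // ts jA /=.
  by rewrite /e /r /= ler_pdivlMr // lerBrDl mulrC.
split=> [u B uT|i u uT].
  by rewrite /raise; case: ifP => _; rewrite ?addr_ge0 ?y0.
rewrite dual_lhs_raise //; case: ifP => [/andP[tu iA]|_]; last by rewrite addr0 yf.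
have uT' : u < (horizon I).+1 by move: uT; rewrite mem_times ltnS => /andP[].
have := minr (i, Ordinal uT'); rewrite /P /= uT tu iA => /(_ isT).
by rewrite /r /= ler_pdivlMr // lerBrDl mulrC.
Qed.

(** * The growing phase: invariant, termination and progress; weak duality *)

Lemma dual_lhs_raise_ge y t A e j s : t \in times I -> (0 <= e)%R ->
  (dual_lhs I y j s <= dual_lhs I (raise y t A e) j s)%R.
Proof.
move=> tT e0; rewrite dual_lhs_raise // lerDl.
by case: ifP => // _; rewrite mulr_ge0 ?ler0n.
Qed.

Definition growth_invariant st : Prop :=
  [/\ wf_marks I (marks st),
      forall s, members st s = covered I (marks st) s,
      forall j t, xvar st j t = has (fun m => m.1 == (j, t)) (marks st),
      dual_feasible I (dual st)
    & (forall j t a, (j, t, a) \in marks st ->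
         dual_lhs I (dual st) j t = (f j t)%:R%R) /\
      (forall t A, t \in times I -> dual st t A <> 0%R ->
         exists ms0, [/\ suffix ms0 (marks st), A = covered I ms0 t
           & forall s, s \in times I ->
               residual I s (covered I ms0 s) <= residual I t A])].

(** Tightness persists: raising a variable lowers no left-hand side, and feasibility keeps it below
    the right-hand side. The stage [ms0] of a raised variable consists of the marks set before the
    raise, where [selected] gives maximality. *)
Lemma reachable_invariant st : reachable I st -> growth_invariant st.
Proof.
elim=> {st} [|st st' _ [wf mE xE df [tight raised]] step].
  split=> // [s|].
  - by apply/setP => j; rewrite !inE andbF.
  - split=> // j s _; rewrite /dual_lhs big1 ?ler0n // => t _.
    by rewrite big1 // => A _; rewrite mulr0.
case: step => t e j u [tT tmax _] _ [e0 df' _] [uT tu jA jtight] _.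
split=> //=.
- split=> //=; first by exists t => //; rewrite tu -mE.
  by apply: eq_filter => s; rewrite mE.
- move=> s; apply/setP => i; rewrite covered_cons /= mE.
  case: (boolP (s \in times I)) => sT /=; last by rewrite inE (negPf sT).
  by case: (s <= u); rewrite ?in_setU1 ?andbF ?andbT // eq_sym.
- move=> i s; rewrite xE [in RHS]eq_sym xpair_eqE.
  by case: ifP.
split=> [i s a|s B sT].
  rewrite inE => /orP[/eqP[-> -> _]//|im]; apply: le_anti.
  have sT : s \in times I.
    elim: (marks st) wf im => //= m ms IH [mT _ _ wf].
    by rewrite inE => /orP[/eqP E|/(IH wf)//]; rewrite -E in mT.
  by rewrite (df'.2 _ _ sT) -(tight _ _ _ im) dual_lhs_raise_ge.
rewrite /raise; case: ifP => [/andP[/eqP -> /eqP ->] _|_ /(raised _ _ sT)[ms0 [suf BE resB]]].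
  exists (marks st); split; [exact: suffix_cons|exact: mE|].
  by move=> v vT; rewrite -mE; apply: tmax.
exists ms0; split=> //; apply: suffix_trans suf _; exact: suffix_cons.
Qed.

Definition uncovered_size st : nat := \sum_(t <- times I) #|~: members st t|.

(** The blocking job is outside the selected set and joins it, while no set shrinks; hence the
    growing phase terminates. *)
Lemma grow_step_uncovered st st' :
  grow_step I st st' -> uncovered_size st' < uncovered_size st.
Proof.
case=> t e j u [tT _ _] _ _ [uT tu jA _] _.
rewrite /uncovered_size !(bigD1_seq t) ?iota_uniq //= tT tu -addSn.
apply: leq_add; last first.
  apply: leq_sum => s _; apply: subset_leq_card; rewrite setCS.
  by case: ifP => // _; apply: subsetU1.
apply: proper_card; rewrite properC properE subsetU1.
by apply/subsetPn; exists j; rewrite // setU11.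
Qed.

Lemma grow_step_Acc st : Acc (fun st' st : state R J => grow_step I st st') st.
Proof.
have [n] := ubnP (uncovered_size st); elim: n st => [st lt0|n IH st lt].
  (* [done] diverges on a goal [Acc _ _] *)
  by exfalso; rewrite ltn0 in lt0.
apply: Acc_intro => st' step; apply: IH.
by apply: (leq_trans (grow_step_uncovered step)); rewrite -ltnS.
Qed.

Lemma selected_exists (A : nat -> {set J}) t0 :
  t0 \in times I -> exists t, selected I A t.
Proof.
move=> t0T; have lt0 : t0 < (horizon I).+1.
  by move: t0T; rewrite mem_times ltnS => /andP[].
pose P (t : 'I_(horizon I).+1) := (t : nat) \in times I.
case: (@arg_maxnP _ (Ordinal lt0) P (fun t => residual I t (A t)) t0T) => t1 t1T max1.
pose Q (t : 'I_(horizon I).+1) := P t && (residual I t (A t) == residual I t1 (A t1)).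
have Q1 : Q t1 by rewrite /Q eqxx andbT.
case: (@arg_maxnP _ t1 Q (fun t => t : nat) Q1) => t /andP[tT /eqP rest] max2.
have lift s : s \in times I -> exists2 u : 'I_(horizon I).+1, P u & s = u.
  move=> sT; have ls : s < (horizon I).+1.
    by move: sT; rewrite mem_times ltnS => /andP[].
  by exists (Ordinal ls).
exists t; split=> // s /lift[u uT ->]; rewrite rest; first exact: max1.
by move=> /eqP resu; apply: max2; rewrite /Q uT.
Qed.

Lemma grow_progress st : dual_feasible I (dual st) ->
  stopped I st \/ exists st', grow_step I st st'.
Proof.
move=> df; case: (boolP (all (fun t => residual I t (members st t) == 0) (times I))).
  by move=> /allP res0; left=> t /res0/eqP.
case/allPn=> t0 t0T rest0; right.
have [t sel] := selected_exists (members st) t0T.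
have [tT tmax _] := sel.
have rest : 0 < residual I t (members st t).
  by apply: leq_trans (tmax _ t0T); rewrite lt0n.
have [e [mr [j [s bl]]]] := exists_max_raise df tT rest.
have [sT ts jA js] := bl.
pose y := raise (dual st) t (members st t) e.
pose P (i : J * 'I_(horizon I).+1) :=
  [&& (i.2 : nat) \in times I, t <= i.2, i.1 \notin members st t
    & dual_lhs I y i.1 i.2 == (f i.1 i.2)%:R%R].
have lift i u : blocking I y t (members st t) i u ->
    exists2 v : 'I_(horizon I).+1, P (i, v) & u = v.
  case=> uT tu iA iu; have lu : u < (horizon I).+1.
    by move: uT; rewrite mem_times ltnS => /andP[].
  by exists (Ordinal lu); rewrite // /P uT tu iA iu eqxx.
have [v Pv _] := lift _ _ bl.
case: (@arg_maxnP _ (j, v) P (fun i => i.2 : nat) Pv) => -[i u] /and4P[/= uT tu iA /eqP iu] maxu.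
exists (mark I st y i u); apply: (GrowStep sel rest mr) => //.
by move=> i' s' /lift[w Pw ->]; apply: (maxu _ Pw).
Qed.

(* Jobs completed after the horizon, which idle time makes possible, are charged
   at the horizon, the last time having a dual constraint. *)
Lemma schedule_cost_ge y (C : J -> nat) :
  dual_feasible I y -> is_schedule I C ->
  (\sum_(t <- times I) \sum_(A : {set J}) (residual I t A)%:R * y t A
     <= (cost I C)%:R)%R.
Proof.
case=> y0 yf schC; pose c j := minn (C j) (horizon I).
have cT j : c j \in times I.
  rewrite mem_times /c geq_minr andbT leq_min; have := proc_gt0 I j.
  have := sum_proc_le_horizon I [set j]; rewrite big_set1.
  by have := schC.1 j; lia.
apply: (@le_trans _ _ (\sum_j dual_lhs I y j (c j))%R).
  rewrite sum_dual_lhs big_seq_cond [leRHS]big_seq_cond.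
  apply: ler_sum => t /andP[tT _]; apply: ler_sum => A _.
  apply: ler_wpM2r; first exact: y0.
  rewrite ler_nat (leq_trans (knapsack_cover A schC tT)) //.
  apply: leq_sum_sub => j /andP[tC ->]; rewrite andbT leq_min tC.
  by move: tT; rewrite mem_times => /andP[].
rewrite /cost natr_sum; apply: ler_sum => j _.
apply: le_trans (yf j _ (cT j)) _; rewrite ler_nat; apply: jobcost_mono.
  by have := cT j; rewrite mem_times => /andP[].
exact: geq_minl.
Qed.

(** * The due dates and the cost of the output *)

Lemma stopped_due_dates st : reachable I st -> stopped I st ->
  exists d, [/\ forall j t, prune I st j t = (t == d j),
    forall j, d j \in times I, covering I d
  & forall j, exists s, critical I (marks st) [::] d j s].
Proof.
move=> /reachable_invariant[wf mE xE _ _] stop.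
(* Before pruning no due date is kept, encoded by 0, and all demands are covered because every
   residual is zero. *)
have : pruned I (marks st) (marks st) (xvar st) (members st) (fun=> 0).
  split=> // [j s|j t|s sT].
  - rewrite mE; case: (boolP (s \in times I)) => [sT|/negPf sT]; last by rewrite inE sT.
    by case: s sT => [|s _]; rewrite ?ltn0 ?orbF // mem_times.
  - by rewrite xE orbF.
  - by have := stop _ sT; rewrite /residual => /eqP; rewrite subn_eq0.
case/(foldl_prune_pruned wf (suffix_refl _)) => d /pruned_due_dates[dT xd cov crit].
by exists d.
Qed.

Lemma output_cost_le st C Copt :
  reachable I st -> stopped I st -> outputs I st C -> is_schedule I Copt ->
  cost I C <= 4 * cost I Copt.
Proof.
move=> rst stop [d' [d'E edd]] schopt.
have [d [dE dT cov crit]] := stopped_due_dates rst stop.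
have [wf _ _ df [tight raised]] := reachable_invariant rst.
have dd' j : d' j = d j by apply/eqP; rewrite -dE d'E.
have {}edd : edd_schedule I d C.
  case: edd => s [sE ss CE]; exists s; split=> //.
  by rewrite (eq_sorted (e' := fun i j => d' i <= d' j)) // => i j; rewrite !dd'.
have Cd := edd_meets_due_dates dT cov edd.
have schC := edd_is_schedule edd.
set y := dual st in df tight raised.
have Cle : ((cost I C)%:R <= \sum_j dual_lhs I y j (d j) :> R)%R.
  rewrite /cost natr_sum; apply: ler_sum => j _.
  (* Criticality exhibits the kept mark [(j, d j)] in the list, and the constraint of every mark is
     tight. *)
  have [s [_ _ [ms' [a [_ suf _ _]]]]] := crit j.
  rewrite (tight j (d j) a); last first.
    by case/suffixP: suf => l ->; rewrite mem_cat mem_head orbT.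
  rewrite ler_nat; apply: jobcost_mono (Cd j).
  by apply: leq_trans (schC.1 j); apply: proc_gt0.
rewrite -(ler_nat R); apply: le_trans Cle _; rewrite natrM.
apply: le_trans (ler_wpM2l _ (schedule_cost_ge df schopt)); last exact: ler0n.
rewrite sum_dual_lhs mulr_sumr big_seq_cond [leRHS]big_seq_cond.
apply: ler_sum => t /andP[tT _]; rewrite mulr_sumr; apply: ler_sum => A _.
case: (eqVneq (y t A) 0%R) => [->|/eqP yn0]; first by rewrite !mulr0.
have [ms0 [suf AE resA]] := raised t A tT yn0.
rewrite mulrA ler_wpM2r ?df.1 // -natrM ler_nat AE.
by apply: raised_sum_le suf crit tT _ => s sT; rewrite -AE resA.
Qed.

End PrimalDual.

Theorem theorem6 (R : realFieldType) (J : finType) (I : instance J) :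
  (* every execution terminates and outputs a schedule *)
  [/\ Acc (fun st' st : state R J => grow_step I st st') (init_state R J),
      (forall st : state R J, reachable I st ->
         stopped I st \/ exists st', grow_step I st st'),
      (forall st : state R J, reachable I st -> stopped I st ->
         exists C, outputs I st C)
  (* every output is a schedule of cost at most four times the optimum *)
    & (forall (st : state R J) (C : J -> nat),
         reachable I st -> stopped I st -> outputs I st C ->
         is_schedule I C /\
         forall Copt : J -> nat, is_optimal I Copt ->
           cost I C <= 4 * cost I Copt)].
Proof.
split=> [|st rst|st rst stop|st C rst stop out].
- exact: grow_step_Acc.
- by have [_ _ _ df _] := reachable_invariant rst; apply: grow_progress.
- have [d [dE _ _ _]] := stopped_due_dates rst stop.
  by have [C edd] := edd_exists I d; exists C, d.
split=> [|Copt [schopt _]]; last first.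
  exact: output_cost_le rst stop out schopt.
by case: out => d [_ /edd_is_schedule].
Qed.
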